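(* Suppose that $\tilde A$ is invertible. Then the origin is the only equilibrium of the closed-loop system $\dot x=F(x)$ if and only if the number of positive real eigenvalues of $\tilde A$, counted with algebraic multiplicity, is even.
   Context: Data: $A\in\mathbb{R}^{n\times n}$, $B\in\mathbb{R}^{n\times m}$ with $(A,B)$ stabilizable; $c\in\mathbb{R}^n$, $d\in\mathbb{R}$ with $d>0$; $h(x)=c^\top x+d$. The integer $r\ge 1$ is the relative degree of $h$ for $\dot x=Ax+Bu$: $c^\top A^iB=0$ for $0\le i\le r-2$ and $c^\top A^{r-1}B\neq 0$. $\alpha_1,\dots,\alpha_r>0$ are constants and $\alpha=\prod_{i=1}^r\alpha_i$. $G\in\mathbb{R}^{m\times m}$ is symmetric positive definite. $K\in\mathbb{R}^{m\times n}$ is a nominal gain such that $A_0:=A-BK$ is Hurwitz (all eigenvalues have negative real part). Notation: $\phi(s)=\prod_{j=1}^{r}(s+\alpha_j)$; $\theta=c^\top A^{r-1}B\,G^{-1}B^\top(A^\top)^{r-1}c>0$; $v_1=-\frac{1}{\theta}B\,G^{-1}B^\top(A^\top)^{r-1}c$; $v_2^\top=c^\top(\phi(A)-A^{r-1}BK)$; $\tilde A=A_0+v_1v_2^\top$; $\tilde b=\alpha d\,v_1$; $\eta(x)=v_2^\top x+\alpha d$. Closed-loop system: $\dot x=F(x)$ with $F(x)=A_0x$ if $\eta(x)\ge 0$ and $F(x)=\tilde A x+\tilde b$ if $\eta(x)<0$. It arises from $\dot x=Ax+Bu^*(x)$, where $u^*(x)$ is the safety filter, i.e. the minimizer of $\frac12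 (u+Kx)^\top G(u+Kx)$ over $u\in\mathbb{R}^m$ subject to $c^\top\phi(A)x+c^\top A^{r-1}Bu+\alpha d\ge 0$. An equilibrium is a point $x$ with $F(x)=0$. *)

(* Defs.v *)
From HB Require Import structures.
From mathcomp Require Import all_boot all_order all_algebra.
From mathcomp Require Import complex polyrcf.
From mathcomp Require Import reals.

Set Implicit Arguments.
Unset Strict Implicit.
Unset Printing Implicit Defensive.

Import Order.TTheory GRing.Theory Num.Theory.

Local Open Scope ring_scope.

Definition hurwitz (R : realType) (n : nat) (M : 'M[R]_n) : Prop :=
  forall z : R[i], eigenvalue (map_mx (real_complex R) M) z -> complex.Re z < 0.

Definition stabilizable (R : realType) (n m : nat)
    (A : 'M[R]_n) (B : 'M[R]_(n, m)) : Prop :=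
  exists K : 'M[R]_(m, n), hurwitz (A - B *m K).

Definition sym_posdef (R : realType) (m : nat) (G : 'M[R]_m) : Prop :=
  G^T = G /\ forall u : 'cV[R]_m, u != 0 -> 0 < (u^T *m G *m u) 0 0.

(* Relative degree of x |-> c^T x + d for x' = A x + B u; it does not depend
   on d.  The bound i.+1 < r is i <= r - 2 without truncated subtraction. *)
Definition relative_degree (R : realType) (n m : nat)
    (A : 'M[R]_n) (B : 'M[R]_(n, m)) (c : 'cV[R]_n) (r : nat) : Prop :=
  [/\ (0 < r)%N,
      forall i : nat, (i.+1 < r)%N -> c^T *m A ^+ i *m B = 0
    & c^T *m A ^+ r.-1 *m B != 0].

(* rootsR p lists the distinct real roots of p != 0; mup a p is the
   multiplicity of a as a root of p. *)
Definition num_pos_real_eigenvalues (R : realType) (n : nat) (M : 'M[R]_n) :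
    nat :=
  \sum_(a <- rootsR (char_poly M) | 0 < a) mup a (char_poly M).

Definition is_equilibrium (R : realType) (n : nat)
    (F : 'cV[R]_n -> 'cV[R]_n) (x : 'cV[R]_n) : Prop := F x = 0.

Section ClosedLoop.

Context (R : realType) (n m r : nat).
Context (A : 'M[R]_n) (B : 'M[R]_(n, m)) (c : 'cV[R]_n) (d : R).
Context (alpha : 'I_r -> R) (G : 'M[R]_m) (K : 'M[R]_(m, n)).

(* phi(A) for phi(s) = \prod_j (s + alpha_j); written out directly because
   horner_mx requires a dimension of the form n.+1.  The factors commute. *)
Definition phiA : 'M[R]_n := \prod_(j < r) (A + (alpha j)%:M).

Definition alpha_prod : R := \prod_(j < r) alpha j.

Definition A0 : 'M[R]_n := A - B *m K.

Definition theta : R :=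
  (c^T *m A ^+ r.-1 *m B *m invmx G *m B^T *m (A^T) ^+ r.-1 *m c) 0 0.

Definition v1 : 'cV[R]_n :=
  - theta^-1 *: (B *m invmx G *m B^T *m (A^T) ^+ r.-1 *m c).

Definition v2 : 'cV[R]_n :=
  (c^T *m (phiA - A ^+ r.-1 *m B *m K))^T.

Definition Atilde : 'M[R]_n := A0 + v1 *m v2^T.

Definition btilde : 'cV[R]_n := (alpha_prod * d) *: v1.

Definition eta (x : 'cV[R]_n) : R := (v2^T *m x) 0 0 + alpha_prod * d.

Definition closed_loop (x : 'cV[R]_n) : 'cV[R]_n :=
  if 0 <= eta x then A0 *m x else Atilde *m x + btilde.

End ClosedLoop.

(* Main.v *)
Require Import Defs.
From HB Require Import structures.
From mathcomp Require Import all_boot all_order all_algebra.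
From mathcomp Require Import complex polyrcf.
From mathcomp Require Import reals.

(** Why the theorem is true.  Write [k = alpha_prod * d > 0] and
    [w = v2^T Atilde^-1 v1].  Where [0 <= eta x] the field is [A0 x], and the
    Hurwitz matrix [A0] is invertible, so only the origin can be an equilibrium
    there (and it is one, because [eta 0 = k > 0]).  Where [eta x < 0], a zero
    of the affine field must be the point [x' = - k Atilde^-1 v1], at which
    [eta x' = k (1 - w)].  Hence a second equilibrium exists exactly when
    [1 - w < 0].

    Since [A0 = Atilde - v1 v2^T], the determinant of a rank-one update
    ([det_rank1_update]) gives [det (- A0) = det (- Atilde) * (1 - w)].  Now
    [det (- M)] is the value at 0 of the characteristic polynomial of [M], and
    a monic real polynomial that does not vanish at 0 takes there a value of
    sign [(-1) ^ N], where [N] counts its positive roots with multiplicity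
    ([sg_horner0_monic]): each positive root [a] contributes a factor [- a],
    and what remains keeps the sign that it has at infinity.  For [A0] there is
    no nonnegative root, so [det (- A0) > 0]; therefore [1 - w] has the sign
    [(-1) ^ N] of [det (- Atilde)], which is positive exactly when [N] is
    even. *)

Set Implicit Arguments.
Unset Strict Implicit.
Unset Printing Implicit Defensive.

Import Order.TTheory GRing.Theory Num.Theory.

Local Open Scope ring_scope.

(** Roots can be divided out one at a time: the powers already extracted do not
    vanish at a new point, so the quotient keeps the multiplicity that [p] has
    there. *)
Lemma prod_XsubC_mup_factor (F : fieldType) (p : {poly F}) (s : seq F) :
  p != 0 -> uniq s ->
  exists2 q : {poly F},
    p = \prod_(a <- s) ('X - a%:P) ^+ mup a p * q
    & {in s, forall a, ~~ root q a}.
Proof.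
move=> p_neq0; elim: s => [|b s IHs] /=.
  by move=> _; exists p => //; rewrite big_nil mul1r.
case/andP=> bs /IHs[q def_p q_s].
have q_neq0 : q != 0.
  by apply: contra_neq p_neq0 => q0; rewrite def_p q0 mulr0.
have mup_bq : mup b q = mup b p.
  rewrite [in RHS]def_p mupMr // rootE horner_prod prodf_seq_neq0.
  apply/allP=> a a_s /=; rewrite hornerE hornerXsubC expf_neq0 // subr_eq0.
  by apply: contraNneq bs => ->.
have dvd_bq : ('X - b%:P) ^+ mup b p %| q by rewrite -mup_bq -mup_geq.
exists (q %/ ('X - b%:P) ^+ mup b p).
  by rewrite big_cons mulrAC mulrC [_ * (q %/ _)]mulrC divpK.
have def_q := divpK dvd_bq.
move=> a; rewrite inE => /predU1P[->|a_s]; last first.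
  by have := q_s a a_s; rewrite -{1}def_q rootM negb_or => /andP[].
(* A further root at b would raise the multiplicity beyond its maximum. *)
rewrite -dvdp_XsubCl; apply/negP=> dvd_b.
suff : (mup b q < mup b q)%N by rewrite ltnn.
rewrite {1}mup_bq mup_geq // exprS -[X in _ %| X]def_q.
exact: dvdp_mul.
Qed.

(** Without a root on the half-line the sign at 0 is the sign at infinity. *)
Lemma horner0_gt0_monic (R : rcfType) (p : {poly R}) :
  p \is monic -> (forall x, 0 <= x -> ~~ root p x) -> 0 < p.[0].
Proof.
move=> p_monic p_noroot; rewrite -sgr_gt0.
rewrite (@sgp_pinftyP _ 0) ?in_itv /= ?lexx //; last first.
  by move=> x; rewrite in_itv /= andbT => /p_noroot.
by rewrite /sgp_pinfty (monicP p_monic) sgr1.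
Qed.

(** Only the positive roots change the sign between 0 and infinity, each as
    often as its multiplicity. *)
Lemma sg_horner0_monic (R : rcfType) (p : {poly R}) :
  p \is monic -> ~~ root p 0 ->
  Num.sg p.[0] = (-1) ^+ (\sum_(a <- rootsR p | 0 < a) mup a p).
Proof.
move=> p_monic p0_neq0; have p_neq0 := monic_neq0 p_monic.
rewrite -big_filter; set s := filter _ _.
have s_uniq : uniq s by rewrite filter_uniq ?uniq_roots.
have [q def_p q_s] := prod_XsubC_mup_factor p_neq0 s_uniq.
have q_monic : q \is monic.
  move: p_monic; rewrite {1}def_p monicMl // monic_prod // => a _.
  by rewrite monic_exp ?monicXsubC.
have q0_gt0 : 0 < q.[0].
  apply: horner0_gt0_monic => // x x_ge0; apply/negP=> qx.
  have px : root p x by rewrite def_p rootM qx orbT.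
  have x_neq0 : x != 0 by apply: contraNneq p0_neq0 => <-.
  have x_s : x \in s.
    rewrite mem_filter lt0r x_neq0 x_ge0 /=.
    by rewrite -(roots_on_rootsR p_neq0) in_itv /= px.
  by have := q_s x x_s; rewrite qx.
rewrite [in LHS]def_p hornerM sgrM (gtr0_sg q0_gt0) mulr1 horner_prod.
rewrite -prodrXr (big_morph _ (@sgrM R) (sgr1 R)) big_seq [in RHS]big_seq.
apply: eq_bigr => a; rewrite mem_filter => /andP[a_gt0 _].
by rewrite hornerE hornerXsubC sub0r sgrX sgrN gtr0_sg.
Qed.

(** Both sides are the determinant of [block_mx 1 (- u) v 1], eliminated from
    either corner. *)
Lemma det1_add_mulmx (R : comPzRingType) (n : nat)
    (u : 'cV[R]_n) (v : 'rV[R]_n) :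
  \det (1%:M + u *m v) = 1 + (v *m u) 0 0.
Proof.
have blockE : block_mx 1%:M (- u) 0 1%:M *m block_mx (1%:M + u *m v) 0 v 1%:M
    = block_mx 1%:M 0 v 1%:M *m block_mx 1%:M (- u) 0 (1%:M + v *m u).
  rewrite !mulmx_block !(mul1mx, mulmx1, mul0mx, mulmx0, addr0, add0r).
  by rewrite mulNmx addrK mulmxN addrC addrK.
have := congr1 determinant blockE.
rewrite !det_mulmx !det_ublock !det_lblock !det1 !(mul1r, mulr1) => ->.
by rewrite det_mx11 !mxE eqxx.
Qed.

Lemma det_rank1_update (R : comUnitRingType) (n : nat) (M : 'M[R]_n)
    (u : 'cV[R]_n) (v : 'rV[R]_n) :
  M \in unitmx ->
  \det (M + u *m v) = \det M * (1 + (v *m invmx M *m u) 0 0).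
Proof.
move=> M_unit.
have -> : M + u *m v = M *m (1%:M + (invmx M *m u) *m v).
  by rewrite mulmxDr mulmx1 !mulmxA mulmxV // mul1mx.
by rewrite det_mulmx det1_add_mulmx mulmxA.
Qed.

Lemma horner0_char_poly (R : nzRingType) (n : nat) (M : 'M[R]_n) :
  (char_poly M).[0] = (-1) ^+ n * \det M.
Proof. by rewrite horner_coef0 char_poly_det. Qed.

(** A nonnegative real root of the characteristic polynomial would be a complex
    eigenvalue outside the open left half-plane. *)
Lemma hurwitz_horner0_char_poly_gt0 (R : realType) (n : nat) (M : 'M[R]_n) :
  hurwitz M -> 0 < (char_poly M).[0].
Proof.
move=> M_hurwitz; apply: horner0_gt0_monic (char_poly_monic M) _ => x x_ge0.
apply/negP=> Mx.
suff /M_hurwitz /=: eigenvalue (map_mx (real_complex R) M) x%:C%C.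
  by rewrite ltNge x_ge0.
by rewrite eigenvalue_root_char -map_char_poly fmorph_root.
Qed.

Theorem proposition5 (R : realType) (n m r : nat)
    (A : 'M[R]_n) (B : 'M[R]_(n, m)) (c : 'cV[R]_n) (d : R)
    (alpha : 'I_r -> R) (G : 'M[R]_m) (K : 'M[R]_(m, n))
    (AB_stabilizable : stabilizable A B)
    (d_gt0 : 0 < d)
    (c_reldeg : relative_degree A B c r)
    (alpha_gt0 : forall j : 'I_r, 0 < alpha j)
    (G_posdef : sym_posdef G)
    (A0_hurwitz : hurwitz (A0 A B K))
    (Atilde_unit : Atilde A B c alpha G K \in unitmx) :
  (forall x : 'cV[R]_n,
     is_equilibrium (closed_loop A B c d alpha G K) x <-> x = 0)
  <->
  ~~ odd (num_pos_real_eigenvalues (Atilde A B c alpha G K)).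
Proof.
rewrite /is_equilibrium /closed_loop /btilde /Defs.eta.
set k := alpha_prod alpha * d.
set At := Atilde _ _ _ _ _ _ in Atilde_unit *.
set b := v1 _ _ _ _ _; set v := v2 _ _ _ _ _.
set A0' := A0 _ _ _ in A0_hurwitz *.
have k_gt0 : 0 < k by rewrite mulr_gt0 ?prodr_gt0.
have A0E : A0' = At + (- b) *m v^T by rewrite mulNmx addrK.
pose w := (v^T *m invmx At *m b) 0 0.
have p0_eq : (char_poly A0').[0] = (char_poly At).[0] * (1 - w).
  rewrite !horner0_char_poly A0E det_rank1_update // mulmxN mulrA.
  by rewrite [in LHS]mxE.
have p0_gt0 := hurwitz_horner0_char_poly_gt0 A0_hurwitz.
have A0_unit : A0' \in unitmx.
  rewrite unitmxE unitfE; apply: contraTneq p0_gt0 => det0.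
  by rewrite horner0_char_poly det0 mulr0 ltxx.
have At_noroot0 : ~~ root (char_poly At) 0.
  apply: contraTN p0_gt0 => /rootP At0.
  by rewrite p0_eq At0 mul0r ltxx.
have w_sg : Num.sg (1 - w) = (-1) ^+ num_pos_real_eigenvalues At.
  rewrite -(sg_horner0_monic (char_poly_monic At) At_noroot0).
  (* The product of the two signs is 1, so they agree. *)
  have sq1 : Num.sg (char_poly At).[0] ^+ 2 = 1 by rewrite sqr_sg At_noroot0.
  by rewrite -[LHS]mul1r -[X in X * _]sq1 expr2 -mulrA -sgrM -p0_eq (gtr0_sg p0_gt0) mulr1.
(* The zero of the affine field: an equilibrium when [eta x' < 0]. *)
pose x' := - k *: (invmx At *m b).
have eta_x' : (v^T *m x') 0 0 + k = k * (1 - w).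
  by rewrite -scalemxAr mulmxA mxE -/w mulNr mulrBr mulr1 addrC.
have x'_zero x : (At *m x + k *: b = 0) <-> (x = x').
  split=> [Ftx|->]; last first.
    by rewrite -scalemxAr mulKVmx // scaleNr addNr.
  have Atx : At *m x = - (k *: b) by apply/eqP; rewrite -addr_eq0 Ftx.
  by rewrite -(mulKmx Atilde_unit x) Atx mulmxN -scalemxAr /x' scaleNr.
have even_sg : (~~ odd (num_pos_real_eigenvalues At)) = (0 < 1 - w).
  by rewrite -sgr_gt0 w_sg -signr_odd; case: (odd _); rewrite ?ltr01 // ltr0N1.
rewrite even_sg; split=> [only0 | w_lt1 x].
  rewrite ltNge; apply/negP=> w_ge1.
  have eta_lt0 : (v^T *m x') 0 0 + k < 0.
    rewrite eta_x' pmulr_rlt0 // lt_neqAle w_ge1 andbT.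
    by apply: contraTneq p0_gt0 => w1; rewrite p0_eq w1 mulr0 ltxx.
  have x'0 : x' = 0.
    by apply/only0; rewrite leNgt eta_lt0 /=; apply/x'_zero.
  by move: eta_lt0; rewrite x'0 mulmx0 mxE add0r ltNge ltW.
split=> [|->]; last by rewrite !mulmx0 mxE add0r ltW.
case: ifPn => [_ A0x|]; first by rewrite -(mulKmx A0_unit x) A0x mulmx0.
rewrite -ltNge => eta_lt0 /x'_zero xE; move: eta_lt0.
by rewrite xE eta_x' ltNge ltW // mulr_gt0.
Qed.
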